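(* Let $B\ge 2$ and $d\ge 1$ be coprime integers, and let $n$ be an integer with $n\ge B^d$. Then at least one base-$B$ subword of $n$ is divisible by $d$; that is, if $n=\sum_{k=0}^m x_kB^k$ is the base-$B$ expansion of $n$, there exist $0\le i\le j\le m$ such that $d\mid W(i,j)$.
   Context: For a positive integer $n$ with base-$B$ expansion $n=\sum_{k=0}^m x_kB^k$ (digits $0\le x_k\le B-1$, leading digit $x_m\neq 0$), the base-$B$ subwords of $n$ are the integers $W(i,j)=\sum_{k=i}^{j}x_kB^{k-i}$ for $0\le i\le j\le m$. A subword may equal $0$ (for example if some digit is $0$), and $0$ counts as divisible by every $d$. *)

(* Defs.v *)
From mathcomp Require Import all_boot.

Set Implicit Arguments.
Unset Strict Implicit.
Unset Printing Implicit Defensive.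

(* The digit sequence is a function on nat of which only the values at
   0, ..., m matter; the least significant digit is x 0. *)
Definition base_expansion (B n m : nat) (x : nat -> nat) : Prop :=
  [/\ forall k, k <= m -> x k <= B - 1,
      x m != 0
    & n = \sum_(0 <= k < m.+1) x k * B ^ k].

Definition subword (B : nat) (x : nat -> nat) (i j : nat) : nat :=
  \sum_(i <= k < j.+1) x k * B ^ (k - i).

Lemma base_expansion_exists (B n : nat) :
  1 < B -> 0 < n -> exists m x, base_expansion B n m x.
Proof.
move=> B_gt1; elim/ltn_ind: n => n IHn n_gt0.
have B_gt0 : 0 < B by apply: ltnW.
have [nB|Bn] := ltnP n B.
  exists 0, (fun=> n); split; last by rewrite big_nat1 expn0 muln1.
  - by move=> k _; rewrite subn1 -ltnS prednK.
  - by rewrite -lt0n.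
have [|m [x [xB xm def_n]]] := IHn (n %/ B) (ltn_Pdiv B_gt1 n_gt0).
  by rewrite divn_gt0.
exists m.+1, (fun k => if k is k'.+1 then x k' else n %% B); split=> //.
  by case=> [|k] le_km; [rewrite subn1 -ltnS prednK // ltn_pmod | exact: xB].
rewrite big_nat_recl //= expn0 muln1 {1}(divn_eq n B) {1}def_n addnC.
rewrite big_distrl /=; congr (_ + _); apply: eq_bigr => k _.
by rewrite expnSr mulnA.
Qed.

(* Main.v *)
(* The d + 1 partial sums of the lowest 0, 1, ..., d digits cannot be pairwise
   distinct modulo d; the difference of two congruent ones is B ^ i times a
   subword, and B ^ i is invertible modulo d. *)
Require Import Defs.
From mathcomp Require Import all_boot.

(** By induction: the new top digit adds at most [(B - 1) * B ^ m] to a sum below [B ^ m]. *)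
Lemma digit_sum_lt (B m : nat) (x : nat -> nat) :
  0 < B -> (forall k, k < m -> x k <= B - 1) ->
  \sum_(0 <= k < m) x k * B ^ k < B ^ m.
Proof.
move=> B_gt0; elim: m => [|m IHm] xB; first by rewrite big_nil.
rewrite big_nat_recr //= expnS.
apply: (@leq_trans (B ^ m + (B - 1) * B ^ m)).
  rewrite -addSn leq_add ?leq_mul2r ?xB ?orbT // IHm // => k lt_km.
  exact/xB/ltnW.
by rewrite -mulSn subn1 prednK.
Qed.

Lemma subword_shift (B : nat) (x : nat -> nat) (i j : nat) :
  i <= j.+1 ->
  \sum_(0 <= k < j.+1) x k * B ^ k =
    \sum_(0 <= k < i) x k * B ^ k + B ^ i * subword B x i j.
Proof.
move=> le_ij; rewrite (big_cat_nat (n := i)) //=; congr (_ + _).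
rewrite /subword big_distrr /=; apply: eq_big_nat => k /andP[le_ik _].
by rewrite mulnCA -expnD subnKC.
Qed.

Lemma pigeonhole_modn (d : nat) (f : nat -> nat) :
  0 < d -> exists i j, [/\ i < j, j <= d & f i = f j %[mod d]].
Proof.
move=> d_gt0; pose g (i : 'I_d.+1) := Ordinal (ltn_pmod (f i) d_gt0).
(* An injective [g] would give [d + 1 <= d]. *)
have /injectivePn[i [j neq_ij [eq_fij]]] : ~~ injectiveb g.
  by apply/injectiveP => /leq_card; rewrite !card_ord ltnn.
case: (ltngtP i j) => [lt_ij|lt_ji|/val_inj eq_ij].
- by exists i, j; split=> //; rewrite -ltnS.
- by exists j, i; split=> //; rewrite -ltnS.
- by rewrite eq_ij eqxx in neq_ij.
Qed.

Theorem theorem3p1 (B d n m : nat) (x : nat -> nat)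
    (hB : 2 <= B) (hd : 1 <= d) (hBd : coprime B d) (hn : B ^ d <= n)
    (hx : base_expansion B n m x) :
  exists i j : nat, [/\ i <= j, j <= m & d %| subword B x i j].
Proof.
case: hx => xB _ def_n.
(* Since [B ^ d <= n < B ^ m.+1], the lowest [d] digits all lie within the expansion. *)
have le_dm : d <= m.
  rewrite -ltnS -(ltn_exp2l _ _ hB); apply: leq_ltn_trans hn _.
  by rewrite def_n digit_sum_lt // ltnW.
(* The larger index is positive and is written [j.+1], because a subword includes its end digit
   [j]. *)
have [i [[|j] [lt_ij le_jd eq_ij]]] :=
  pigeonhole_modn d (fun i => \sum_(0 <= k < i) x k * B ^ k) hd.
  by rewrite ltn0 in lt_ij.
exists i, j; split=> //; first exact: leq_trans (ltnW le_jd) le_dm.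
(* The longer sum is put first so that truncated subtraction leaves exactly
   [B ^ i * subword B x i j]. *)
move/eqP: eq_ij; rewrite eq_sym (subword_shift _ _ _ _ (ltnW lt_ij)).
by rewrite eqn_mod_dvd ?leq_addr // addKn Gauss_dvdr // coprime_sym coprimeXl.
Qed.
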